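(* Let $R_1$ be an ordered field, and let $B\in\{0,1\}^{m\times n}$ be a matrix such that, writing $r=\mathrm{K}_{R_1}(B)$, one has $r<\mathrm{K}_{R_2}(B)$ for every field $R_2$ strictly contained in $R_1$. Then there is a sign pattern $S\in\{0,+,-\}^{m\times n}$ such that $S$ is the sign pattern of some matrix over $R_1$ of rank $r$, but, for every field $R_2$ strictly contained in $R_1$, $S$ is not the sign pattern of any matrix over $R_2$ of rank $r$.
   Context: A field $R$ is ordered if it is equipped with a subset $P\subset R$, closed under addition and multiplication, such that $P$, $-P$ and $\{0\}$ form a partition of $R$; elements of $P$ are called positive and those of $-P$ negative. A subfield of an ordered field carries the induced order. The sign pattern of a matrix $A\in R^{m\times n}$ over an ordered field $R$ is the matrix $S\in\{+,-,0\}^{m\times n}$ with $S_{ij}=+$ if $A_{ij}$ is positive, $S_{ij}=-$ if $A_{ij}$ is negative, and $S_{ij}=0$ if $A_{ij}=0$. For a field $\mathbb{F}$, the Kapranov rank $\mathrm{K}_{\mathbb{F}}(B)$ of a matrix $B\in\{0,1\}^{m\times n}$ with respect to $\mathbb{F}$ is the smallest possible rank of a matrix $C\in\mathbb{F}^{m\times n}$ satisfying, for all $i,j$: $C_{ij}=0$ if and only if $B_{ij}=0$. *)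

(* Defs.v *)
From HB Require Import structures.
From mathcomp Require Import all_boot all_order all_algebra.
From mathcomp Require Import boolp.

Set Implicit Arguments.
Unset Strict Implicit.
Unset Printing Implicit Defensive.

Import Order.TTheory GRing.Theory Num.Theory.
Local Open Scope ring_scope.

(* Ordered fields are [realFieldType]s: the order is determined by the set of
   positive elements, and the norm by the order. *)

(* A subfield of F is a subset K : divringClosed F, that is, a subset
   containing 1 and closed under subtraction and division; [subfield_of K] is
   K as a field of its own.  Subsets are boolean predicates, which by the
   classical axioms of [boolp] loses no generality. *)
Section Subfield.
Variables (F : fieldType) (K : divringClosed F).

Record subfield_of : Type :=
  SubfieldOf { subfield_val : F; _ : subfield_val \in K }.

HB.instance Definition _ := [isSub for subfield_val].
HB.instance Definition _ := [Choice of subfield_of by <:].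
HB.instance Definition _ := [SubChoice_isSubIntegralDomain of subfield_of by <:].
HB.instance Definition _ := [SubIntegralDomain_isSubField of subfield_of by <:].

End Subfield.

Section OrderedSubfield.
Variables (R : realFieldType) (K : divringClosed R).
Implicit Types x y : subfield_of K.

Definition subfield_le x y : bool := val x <= val y.
Definition subfield_lt x y : bool := val x < val y.
Definition subfield_norm x : subfield_of K := if subfield_le 0 x then x else - x.

Fact subfield_le0D x y :
  subfield_le 0 x -> subfield_le 0 y -> subfield_le 0 (x + y).
Proof. by rewrite /subfield_le rmorph0 rmorphD; exact: addr_ge0. Qed.

Fact subfield_le0M x y :
  subfield_le 0 x -> subfield_le 0 y -> subfield_le 0 (x * y).
Proof. by rewrite /subfield_le rmorph0 rmorphM; exact: mulr_ge0. Qed.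

Fact subfield_le0_anti x : subfield_le 0 x -> subfield_le x 0 -> x = 0.
Proof. by rewrite /subfield_le => x0 x1; apply/val_inj/le_anti; rewrite x0 x1. Qed.

Fact subfield_sub_ge0 x y : subfield_le 0 (y - x) = subfield_le x y.
Proof. by rewrite /subfield_le rmorph0 rmorphB subr_ge0. Qed.

Fact subfield_le0_total x : subfield_le 0 x || subfield_le x 0.
Proof. exact: le_total. Qed.

Fact subfield_normN x : subfield_norm (- x) = subfield_norm x.
Proof.
rewrite /subfield_norm.
have -> : subfield_le 0 (- x) = subfield_le x 0.
  by rewrite -[- x]sub0r subfield_sub_ge0.
have := @subfield_le0_anti x; have := subfield_le0_total x.
case: ifP => x_ge0; case: ifP => x_le0 _ anti; rewrite ?opprK //.
- by rewrite anti ?oppr0.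
by have := subfield_le0_total x; rewrite x_ge0 x_le0.
Qed.

Fact subfield_ge0_norm x : subfield_le 0 x -> subfield_norm x = x.
Proof. by rewrite /subfield_norm => ->. Qed.

Fact subfield_lt_def x y : subfield_lt x y = (y != x) && subfield_le x y.
Proof. by rewrite /subfield_lt lt_def. Qed.

HB.instance Definition _ := Num.IntegralDomain_isLeReal.Build (subfield_of K)
  subfield_le0D subfield_le0M subfield_le0_anti subfield_sub_ge0
  subfield_le0_total subfield_normN subfield_ge0_norm subfield_lt_def.

End OrderedSubfield.

Inductive sign : Type := Pos | Neg | Zero.

Definition sign_of (R : realFieldType) (x : R) : sign :=
  if 0 < x then Pos else if x < 0 then Neg else Zero.

Definition sign_pattern (R : realFieldType) (m n : nat) (A : 'M[R]_(m, n)) :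
  'M[sign]_(m, n) := map_mx (@sign_of R) A.

(* A 0-1 matrix is encoded as a boolean matrix, with [false] for 0 and
   [true] for 1. *)
Definition has_zero_pattern (F : fieldType) (m n : nat) (B : 'M[bool]_(m, n))
  (C : 'M[F]_(m, n)) : Prop := forall i j, C i j = 0 <-> B i j = false.

Definition pattern_rank (F : fieldType) (m n : nat) (B : 'M[bool]_(m, n)) :
  pred nat := fun k => `[< exists C : 'M[F]_(m, n),
                             has_zero_pattern B C /\ \rank C = k >].

Fact pattern_rank_ex (F : fieldType) (m n : nat) (B : 'M[bool]_(m, n)) :
  exists k, pattern_rank F B k.
Proof.
exists (\rank (map_mx (fun b : bool => b%:R : F) B)).
apply/asboolP; exists (map_mx (fun b : bool => b%:R) B); split=> // i j.
by rewrite mxE; case: (B i j); split=> // /eqP; rewrite oner_eq0.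
Qed.

Definition kapranov_rank (F : fieldType) (m n : nat) (B : 'M[bool]_(m, n)) :
  nat := ex_minn (pattern_rank_ex F B).

(* Main.v *)
Require Import Defs.
From mathcomp Require Import all_boot all_order all_algebra.
From mathcomp Require Import boolp.

Import Order.TTheory.

Local Open Scope ring_scope.

(** A sign pattern determines the positions of the zero entries.  Hence, if [C]
    is a matrix over [R1] with zero pattern [B] and of minimal rank [r], every
    matrix over a subfield with the sign pattern of [C] has zero pattern [B] as
    well, so that its rank is at least the Kapranov rank of [B] over that
    subfield, which exceeds [r] when the subfield is proper.  The sign pattern
    of [C] is thus the required one ([has_zero_pattern_sign], [kapranov_rank_ex],
    [kapranov_rank_le]). *)

Lemma kapranov_rank_ex (F : fieldType) (m n : nat) (B : 'M[bool]_(m, n)) :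
  exists C : 'M[F]_(m, n), has_zero_pattern B C /\ \rank C = kapranov_rank F B.
Proof. by rewrite /kapranov_rank; case: ex_minnP => k /asboolP. Qed.

Lemma kapranov_rank_le (F : fieldType) (m n : nat) (B : 'M[bool]_(m, n))
  (C : 'M[F]_(m, n)) : has_zero_pattern B C -> (kapranov_rank F B <= \rank C)%N.
Proof.
move=> BC; rewrite /kapranov_rank; case: ex_minnP => k _; apply.
by apply/asboolP; exists C.
Qed.

Lemma sign_of_eq0 (R : realFieldType) (x : R) : sign_of x = Zero <-> x = 0.
Proof.
rewrite /sign_of; case: (ltgtP x 0) => // x_sgn; split=> // x0;
  by rewrite x0 ltxx in x_sgn.
Qed.

(** The two matrices may live over different ordered fields: this is what
    carries the zero pattern from a field to its subfields. *)
Lemma has_zero_pattern_sign (R R' : realFieldType) (m n : nat)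
  (B : 'M[bool]_(m, n)) (C : 'M[R]_(m, n)) (A : 'M[R']_(m, n)) :
  sign_pattern A = sign_pattern C -> has_zero_pattern B C ->
  has_zero_pattern B A.
Proof.
move=> /matrixP eqAC BC i j; have := eqAC i j; rewrite !mxE => eq_ij.
by rewrite -BC -!sign_of_eq0 eq_ij.
Qed.

Theorem lemma4p1 (R1 : realFieldType) (m n : nat) (B : 'M[bool]_(m, n)) (r : nat)
  (hr : r = kapranov_rank R1 B)
  (hB : forall R2 : divringClosed R1, (exists x : R1, x \notin R2) ->
    (r < kapranov_rank (subfield_of R2) B)%N) :
  exists S : 'M[sign]_(m, n),
    (exists A : 'M[R1]_(m, n), sign_pattern A = S /\ \rank A = r) /\
    (forall R2 : divringClosed R1, (exists x : R1, x \notin R2) ->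
      ~ exists A : 'M[subfield_of R2]_(m, n), sign_pattern A = S /\ \rank A = r).
Proof.
have [C [BC rankC]] := kapranov_rank_ex R1 m n B.
exists (sign_pattern C); split; first by exists C; rewrite hr.
move=> R2 /hB r_lt [A [signA rankA]].
have BA := has_zero_pattern_sign _ _ _ _ _ _ _ signA BC.
by have := kapranov_rank_le _ _ _ _ _ BA; rewrite rankA leqNgt r_lt.
Qed.
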